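(* For all integers $n\geq 3$ and $m\geq n+1$, there exists a function $F:\mathbb{M}^{m\times n}\to\mathbb{R}$ such that $F$ is rank-$(n-1)$ convex but not $\mathcal{S}$-quasiconvex.
   Context: $\mathbb{M}^{m\times n}$ denotes the space of real $m\times n$ matrices, and $\mathbb{T}^{n}:=(0,1)^{n}$; a function on $\mathbb{R}^n$ is $\mathbb{T}^n$-periodic if it is $1$-periodic in each coordinate. A function $f:\mathbb{M}^{m\times n}\to\mathbb{R}$ is rank-$(n-1)$ convex if for every $A,V\in\mathbb{M}^{m\times n}$ with $\mathrm{rank}(V)\leq n-1$ the function $t\mapsto f(A+tV)$ is convex on $\mathbb{R}$. For a smooth matrix field $B:\mathbb{R}^n\to\mathbb{M}^{m\times n}$, $\mathrm{Div}\,B$ is the divergence taken on each row, i.e. $(\mathrm{Div}\,B)_i=\sum_{j=1}^n\partial_{x_j}B_{ij}$ for $i=1,\dots,m$. A function $f:\mathbb{M}^{m\times n}\to\mathbb{R}$ is $\mathcal{S}$-quasiconvex if for each smooth $\mathbb{T}^n$-periodic matrix field $B:\mathbb{R}^n\to\mathbb{M}^{m\times n}$ with $\mathrm{Div}\,B=0$ one has $$\int_{\mathbb{T}^n} f(B)\,dx\geq f\left(\int_{\mathbb{T}^n}B\,dx\right).$$ *)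

(* Defs.v *)
From HB Require Import structures.
From mathcomp Require Import all_boot all_order all_algebra.
From mathcomp Require Import all_classical all_reals all_analysis.

Set Implicit Arguments.
Unset Strict Implicit.
Unset Printing Implicit Defensive.

Import Order.TTheory GRing.Theory Num.Theory.
Import numFieldNormedType.Exports.

Local Open Scope classical_set_scope.
Local Open Scope ring_scope.

Section lebesgue_tuple.
Context {R : realType}.

(* R^n as a measurable space: n-tuples of reals with the product of the Borel
   sigma-algebras. *)
Definition tupleR (n : nat) : measurableType _ :=
  [the measurableType _ of n.-tuple (measurableTypeR R)].

Definition consR (n : nat) (p : tupleR n * measurableTypeR R) : tupleR n.+1 :=
  [tuple of p.2 :: p.1].

Lemma measurable_consR (n : nat) : measurable_fun [set: _] (@consR n).
Proof. exact: measurable_cons. Qed.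

Definition leb_step (n : nat) (mu : {measure set (tupleR n) -> \bar R}) :
    set (tupleR n.+1) -> \bar R :=
  pushforward (mu \x (@lebesgue_measure R))%E (@consR n).

HB.instance Definition _ (n : nat) (mu : {measure set (tupleR n) -> \bar R}) :=
  Measure.copy (leb_step mu)
    (measure_function_pushforward__canonical__measure_function_Measure
       (mu \x (@lebesgue_measure R))%E (@measurable_consR n)).

(* n-dimensional Lebesgue measure (on Borel sets), as the n-fold product of
   the one-dimensional one; see [lebesgue_tuple_box]. *)
Fixpoint lebesgue_tuple (n : nat) : {measure set (tupleR n) -> \bar R} :=
  match n with
  | 0 => \d_([tuple] : tupleR 0)
  | n'.+1 =>
      leb_step (lebesgue_tuple n')
  end.

Lemma lebesgue_tuple_box (n : nat) (A : 'I_n -> set (measurableTypeR R)) :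
  (forall i, measurable (A i)) ->
  lebesgue_tuple n [set t | forall i, A i (tnth t i)] =
  (\prod_(i < n) lebesgue_measure (A i))%E.
Proof.
elim: n A => [|n IHn] A mA.
  rewrite big_ord0 /= diracE mem_set//= => -[].
  by [].
rewrite big_ord_recl /= /leb_step /pushforward.
rewrite (_ : _ @^-1` _ =
    [set t : tupleR n | forall i, A (lift ord0 i) (tnth t i)] `*` A ord0).
  rewrite product_measure1E//; last first.
    rewrite (_ : mkset _ =
        \bigcap_(i in [set: 'I_n]) ((@tnth n _) ^~ i @^-1` A (lift ord0 i))).
      apply: fin_bigcap_measurable => // i _.
      rewrite -[X in measurable X]setTI.
      exact: measurable_tnth.
    by apply/seteqP; split=> t /= At i; [move=> _|]; exact: At.
  by rewrite muleC; congr (_ * _)%E; exact: IHn.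
apply/seteqP; split=> -[t x] /=.
  move=> Atx; split; last by have := Atx ord0; rewrite tnth0.
  by move=> i; have := Atx (lift ord0 i); rewrite tnthS.
move=> [At Ax] i; case: (unliftP ord0 i) => [j|] ->; last by rewrite tnth0.
by rewrite tnthS.
Qed.

End lebesgue_tuple.

(* Real-valued Lebesgue integral over (0,1)^n. It is total: a g that is not
   integrable there gets the default value of [Rintegral]. In [S_quasiconvex]
   this does not occur for the f of interest: a rank-k convex f with k >= 1 is
   continuous, so its composition with a smooth periodic field is continuous
   and bounded. *)
Definition cube_integral {R : realType} (n : nat) (g : 'rV[R]_n -> R) : R :=
  (\int[lebesgue_tuple n]_(t in [set t | forall i, tnth t i \in `]0, 1[])
     g (\row_i tnth t i))%R.

Definition cube_integral_mx {R : realType} (m n : nat)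
    (B : 'rV[R]_n -> 'M[R]_(m, n)) : 'M[R]_(m, n) :=
  \matrix_(i, j) cube_integral (fun x => B x i j).

Section fields.
Context {R : realType}.

Definition basis_vec (n : nat) (j : 'I_n) : 'rV[R]_n := delta_mx 0 j.

Definition periodic_field (n : nat) (T : Type) (B : 'rV[R]_n -> T) : Prop :=
  forall x j, B (x + basis_vec j) = B x.

(* Class C^k: all partial derivatives of order at most k exist everywhere and
   are continuous. *)
Fixpoint classC (n : nat) (W : normedModType R) (k : nat)
    (B : 'rV[R]_n -> W) : Prop :=
  match k with
  | 0 => continuous B
  | k'.+1 => continuous B /\
      forall j : 'I_n, (forall x, derivable B x (basis_vec j)) /\
        classC k' (fun x => 'D_(basis_vec j) B x)
  end.

Definition smooth (n : nat) (W : normedModType R) (B : 'rV[R]_n -> W) : Prop :=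
  forall k, classC k B.

Definition Div (m n : nat) (B : 'rV[R]_n -> 'M[R]_(m, n)) (x : 'rV[R]_n) :
    'cV[R]_m :=
  \col_i \sum_(j < n) 'D_(basis_vec j) (fun y => B y i j) x.

Definition rank_convex (m n k : nat) (f : 'M[R]_(m, n) -> R) : Prop :=
  forall A V : 'M[R]_(m, n), (\rank V <= k)%N ->
    convex_function [set: R^o] (fun t : R^o => f (A + t *: V)).

Definition S_quasiconvex (m n : nat) (f : 'M[R]_(m, n) -> R) : Prop :=
  forall B : 'rV[R]_n -> 'M[R]_(m, n),
    smooth B -> periodic_field B -> (forall x, Div B x = 0) ->
    f (cube_integral_mx B) <= cube_integral (fun x => f (B x)).

End fields.

(* Main.v *)
(* Following Sverak's example of a rank-one convex function that is
   not quasiconvex: the plane waves [cos (k . x) V] with [V k = 0] are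
   solenoidal, so we look for three matrices [V_a], [V_b], [V_c] annihilating
   the resonant frequencies [e_0], [e_1], [e_0 + e_1] and such that a
   combination [a V_a + b V_b + c V_c] has rank less than [n] only if at most
   one of [a], [b], [c] is nonzero.  Then [- a b c] is affine in all singular
   directions of the span, but its average along the three waves is
   [- 1/4 < 0], although they have mean zero.  Adding a small multiple of
   [S + S^2], with [S = a^2 + b^2 + c^2], and a large multiple of the squared
   distance to the span (measured by the remainder of a linear projection)
   makes the function rank-(n-1) convex on all matrices: the quartic term wins
   for large [(a, b, c)], and for bounded [(a, b, c)] the products [b c], [a c],
   [a b] of the coordinates of a singular direction are controlled by its
   remainder. *)

From HB Require Import structures.
Require Import Defs.
From mathcomp Require Import all_boot all_order all_algebra.
From mathcomp Require Import all_classical all_reals all_analysis.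
From mathcomp Require Import measurable_realfun.
From mathcomp Require Import ring lra zify.

Set Implicit Arguments.
Unset Strict Implicit.
Unset Printing Implicit Defensive.

Import Order.TTheory GRing.Theory Num.Theory.
Import numFieldNormedType.Exports.

Local Open Scope ring_scope.

(** * Convexity along lines *)

Section convexity.
Context {R : realType}.
Implicit Types a b c : R.

Lemma convex_realP (f : R -> R) :
  (forall p x y : R, 0 <= p <= 1 ->
    f (p * x + (1 - p) * y) <= p * f x + (1 - p) * f y) ->
  convex_function [set: R^o] (f : R^o -> R^o).
Proof.
move=> fconv t x y _ _; rewrite [leRHS]convRE.
set z := conv _ _ _.
have -> : z = t%:num * x + (1 - t%:num) * y by exact: convRE.
by apply: fconv; apply/andP; split.
Qed.

(* Taylor's formula with integral remainder, the remainder being evaluated by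
   the two-point Radau quadrature rule, which is exact when the second
   derivative is quadratic. *)
Lemma quartic_convex (g0 g1 g2 g3 g4 : R) :
  (forall t, 0 <= g2 + 3 * g3 * t + 6 * g4 * t ^+ 2) ->
  convex_function [set: R^o] ((fun t : R =>
    g0 + g1 * t + g2 * t ^+ 2 + g3 * t ^+ 3 + g4 * t ^+ 4) : R^o -> R^o).
Proof.
move=> g_ge0; apply: convex_realP => p x y /andP[p0 p1].
pose h t := (g2 + 3 * g3 * t + 6 * g4 * t ^+ 2 : R).
have hh (u : R) : 0 <= h u by exact: g_ge0.
have p1' : 0 <= 1 - p by rewrite subr_ge0.
set z := p * x + (1 - p) * y; rewrite -subr_ge0.
suff -> : p * (g0 + g1 * x + g2 * x ^+ 2 + g3 * x ^+ 3 + g4 * x ^+ 4) +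
    (1 - p) * (g0 + g1 * y + g2 * y ^+ 2 + g3 * y ^+ 3 + g4 * y ^+ 4) -
    (g0 + g1 * z + g2 * z ^+ 2 + g3 * z ^+ 3 + g4 * z ^+ 4) =
    p * (x - z) ^+ 2 * (h z / 3 + h ((x + z) / 2) * 2 / 3) +
    (1 - p) * (y - z) ^+ 2 * (h z / 3 + h ((y + z) / 2) * 2 / 3).
  by apply: addr_ge0; (apply: mulr_ge0; [apply: mulr_ge0 => //; exact: sqr_ge0|]);
    apply: addr_ge0; rewrite !mulr_ge0 ?invr_ge0.
by rewrite /h /z; field.
Qed.

(** By the inequality of arithmetic and geometric means, |x| L <= (x^2 + L^2) / 2 <= S. *)
Lemma norm_le_sqr_div (x S L : R) : 0 < L -> L ^+ 2 <= S -> x ^+ 2 <= S ->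
  `|x| <= S / L.
Proof.
move=> L0 LS xS; rewrite ler_pdivlMr //.
have : `|x| ^+ 2 <= S by rewrite real_normK ?num_real.
have : 0 <= (`|x| - L) ^+ 2 by exact: sqr_ge0.
move: `|x| => y; clear xS; rewrite sqrrB => h1 h2; move: h1 h2 LS.
rewrite (_ : y * L *+ 2 = 2 * (y * L)); last by ring.
move: (y * L) (y ^+ 2) (L ^+ 2) => a b c; lra.
Qed.

Lemma norm_mul_le_half (x y W : R) : x ^+ 2 + y ^+ 2 <= W -> `|x * y| <= W / 2.
Proof.
rewrite normrM -(real_normK (num_real x)) -(real_normK (num_real y)).
move: `|x| `|y| => {}x {}y; have : 0 <= (x - y) ^+ 2 by exact: sqr_ge0.
rewrite sqrrB (_ : x * y *+ 2 = 2 * (x * y)); last by ring.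
by move: (x * y) (y ^+ 2) (x ^+ 2) => a b c; lra.
Qed.

(** Up to sign, the sum on the left is half the second derivative of [- a b c] in the direction
    [(al, be, ga)]. The right side is what [(S + S ^+ 2) / 100] and the remainder term supply
    against it, apart from a nonnegative square. *)
Lemma trilinear_bound (C d a b c al be ga tau2 : R) :
  let W := al ^+ 2 + be ^+ 2 + ga ^+ 2 in
  0 <= tau2 -> 0 <= C -> 225 * d = 100^-1 ->
  `|be * ga| <= d * W + C * tau2 ->
  `|al * ga| <= d * W + C * tau2 ->
  `|al * be| <= d * W + C * tau2 ->
  a * (be * ga) + b * (al * ga) + c * (al * be) <=
  (W + 2 * ((a ^+ 2 + b ^+ 2 + c ^+ 2) * W)) / 100 + 225 * C * tau2.
Proof.
(* The arithmetic of the two cases below, over abstract reals so that it is linear. *)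
have large (w t sw x y z : R) : 0 <= w -> 0 <= t -> x <= sw / 150 ->
    y <= sw / 150 -> z <= sw / 150 -> x + y + z <= (w + 2 * sw) / 100 + 225 * t.
  by lra.
have small (w t sw x y z : R) : 0 <= sw -> 225 * d = 100^-1 -> x <= 75 * (d * w + t) ->
    y <= 75 * (d * w + t) -> z <= 75 * (d * w + t) ->
    x + y + z <= (w + 2 * sw) / 100 + 225 * t.
  move=> sw0 dE hx hy hz.
  have -> : (w + 2 * sw) / 100 = 225 * d * w + 2 * sw / 100 by rewrite dE; ring.
  by move: hx hy hz; rewrite -[225 * d * w]mulrA; move: (d * w) => dw; lra.
move=> W t0 C0 dE; rewrite -mulrA.
set S := a ^+ 2 + b ^+ 2 + c ^+ 2; set T := C * tau2 => hbg hag hab.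
have a2S : a ^+ 2 <= S by rewrite /S -addrA lerDl addr_ge0 ?sqr_ge0.
have b2S : b ^+ 2 <= S by rewrite /S addrAC lerDr addr_ge0 ?sqr_ge0.
have c2S : c ^+ 2 <= S by rewrite /S lerDr addr_ge0 ?sqr_ge0.
have bgW : be ^+ 2 + ga ^+ 2 <= W by rewrite /W -addrA lerDr sqr_ge0.
have agW : al ^+ 2 + ga ^+ 2 <= W by rewrite /W addrAC lerDl sqr_ge0.
have abW : al ^+ 2 + be ^+ 2 <= W by rewrite /W lerDl sqr_ge0.
have W0 : 0 <= W by rewrite !addr_ge0 ?sqr_ge0.
have S0 : 0 <= S by rewrite !addr_ge0 ?sqr_ge0.
have SW0 : 0 <= S * W by rewrite mulr_ge0.
have T0 : 0 <= T by rewrite mulr_ge0.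
have le_norm (x y : R) : x * y <= `|x| * `|y| by rewrite -normrM; exact: ler_norm.
apply: (@le_trans _ _ (`|a| * `|be * ga| + `|b| * `|al * ga| + `|c| * `|al * be|)).
  by rewrite !lerD.
(* Large [S]: the coefficients are at most S / 75 and the products at most W / 2, so the three terms
   add up to at most 2 S W / 100, the share of [S ^+ 2]. *)
have [SL|SL] := leP (75 ^+ 2) S.
  have mul (x y : R) : `|x| <= S / 75 -> `|y| <= W / 2 -> `|x| * `|y| <= S * W / 150.
    move=> hx hy; have -> : S * W / 150 = (S / 75) * (W / 2) by field.
    by apply: ler_pM.
  have p75 : 0 < 75 :> R by [].
  have := mul _ _ (norm_le_sqr_div p75 SL a2S) (norm_mul_le_half bgW).
  have := mul _ _ (norm_le_sqr_div p75 SL b2S) (norm_mul_le_half agW).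
  have := mul _ _ (norm_le_sqr_div p75 SL c2S) (norm_mul_le_half abW).
  by move=> h3 h2 h1; apply: large.
(* Small [S]: the coefficients are at most 75, so the total is at most 225 (d W + T), and 225 d = 1
   / 100 leaves W / 100, the share of [S], plus 225 T. *)
have bnd (x : R) : x ^+ 2 <= S -> `|x| <= 75.
  move=> xS; rewrite -(ler_pXn2r (_ : 0 < 2)%N) ?nnegrE //.
  by rewrite real_normK ?num_real //; apply: le_trans xS (ltW SL).
have mul (x y : R) : `|x| <= 75 -> `|y| <= d * W + T ->
    `|x| * `|y| <= 75 * (d * W + T).
  by move=> hx hy; apply: ler_pM.
have := mul _ _ (bnd _ a2S) hbg; have := mul _ _ (bnd _ b2S) hag.
have := mul _ _ (bnd _ c2S) hab.
by move=> h3 h2 h1; apply: small.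
Qed.

End convexity.

(** * Singular directions *)

Ltac nat_lia :=
  repeat match goal with
  | H : ?T |- _ => match T with context [Real.sort _] => clear H end
  end; lia.

Section kernel_estimate.
Context {R : realType}.
Variables (d e : R).
Hypotheses (d_gt0 : 0 < d) (d_le1 : d <= 1) (e_ge0 : 0 <= e).

Let D := 2 / d.

Let D_ge1 : 1 <= D.
Proof. by rewrite ler_pdivlMr // mul1r (le_trans d_le1) ?ler1n. Qed.

(** One substitution with a pivot of size at least [d]: since [D] is at least 1, |p y| <= e + |x| <=
    2 D^k e, and dividing by [d] costs one more factor [D]. *)
Lemma residual_step (p q x y : R) (k : nat) :
  d <= `|p| -> `|q| <= 1 -> `|p * y + q * x| <= e -> `|x| <= D ^+ k * e ->
  `|y| <= D ^+ k.+1 * e.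
Proof.
move=> dp q1 res hx.
have E1 : e <= D ^+ k * e by rewrite ler_peMl // exprn_ege1.
have qx : `|q * x| <= D ^+ k * e by rewrite normrM (le_trans _ hx) // ler_piMl.
have : `|p * y| <= D ^+ k * e + D ^+ k * e.
  rewrite -[p * y](addrK (q * x)) (le_trans (ler_normB _ _)) //.
  by rewrite lerD // (le_trans res).
rewrite -mulr2n -mulr_natl => py.
have : d * `|y| <= 2 * (D ^+ k * e).
  by rewrite (le_trans _ py) // normrM ler_wpM2r.
rewrite -ler_pdivlMl // => /le_trans; apply; rewrite exprS.
by move: (D ^+ k) => z; rewrite (_ : d^-1 * _ = D * z * e) // /D; ring.
Qed.

Lemma residual_le (k l : nat) (x : R) :
  (k <= l)%N -> `|x| <= D ^+ k * e -> `|x| <= D ^+ l * e.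
Proof. by move=> kl /le_trans; apply; rewrite ler_wpM2r // ler_weXn2l. Qed.

Lemma factors_ge (x y : R) :
  `|x| <= 1 -> `|y| <= 1 -> d <= `|x * y| -> (d <= `|x|) /\ (d <= `|y|).
Proof.
rewrite normrM => x1 y1 dxy; split; apply: le_trans dxy _.
  by rewrite ler_piMr.
by rewrite ler_piMl.
Qed.

(* If [be] is not small, the last rows bound [u i] downwards from [u n = 0];
   otherwise [al] and [ga] are not small, the first three rows bound [u 1],
   [u 0], [u 2] in this order, and the last rows go upwards from [u 2]. *)
Lemma residual_bound (n : nat) (al be ga : R) (u : nat -> R) :
  (3 <= n)%N -> `|al| <= 1 -> `|be| <= 1 -> `|ga| <= 1 ->
  [\/ d <= `|be * ga|, d <= `|al * ga| | d <= `|al * be| ] ->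
  u n = 0 ->
  `|be * u 0%N + ga * u 2%N| <= e ->
  `|ga * u 0%N - ga * u 1%N| <= e ->
  `|al * u 1%N| <= e ->
  (forall i, (3 <= i <= n)%N -> `|be * u i.-1 + al * u i| <= e) ->
  forall i, (i < n)%N -> `|u i| <= D ^+ (n + 3) * e.
Proof.
move=> n3 al1 be1 ga1 dQ un0 r0 r1 r2 ri.
have u1_al : d <= `|al| -> `|u 1%N| <= D ^+ 1 * e.
  move=> dal; apply: (@residual_step al 0 0) => //; rewrite ?normr0 //.
    by rewrite mul0r addr0.
  by rewrite expr0 mul1r.
have be_case : d <= `|be| -> (d <= `|al|) || (d <= `|ga|) ->
    forall i, (i < n)%N -> `|u i| <= D ^+ (n + 3) * e.
  move=> dbe dag.
  have desc k : (k <= n - 2)%N -> `|u (n - k)%N| <= D ^+ k * e.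
    elim: k => [|k IHk] kn; first by rewrite subn0 un0 normr0 expr0 mul1r.
    apply: (@residual_step be al (u (n - k)%N)) => //; last by apply: IHk; nat_lia.
    rewrite (_ : n - k.+1 = (n - k).-1)%N; last by nat_lia.
    by apply: ri; nat_lia.
  have u2 : `|u 2%N| <= D ^+ (n - 2) * e.
    by have := desc (n - 2)%N (leqnn _); rewrite (_ : n - (n - 2) = 2)%N //; nat_lia.
  have u0 : `|u 0%N| <= D ^+ (n - 2).+1 * e.
    exact: (@residual_step be ga (u 2%N)).
  have u1 : `|u 1%N| <= D ^+ (n - 2).+2 * e.
    case/orP: dag => [dal|dga].
      by apply: residual_le (u1_al dal); nat_lia.
    apply: (@residual_step (- ga) ga (u 0%N)); rewrite ?normrN //.
    by rewrite mulNr addrC.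
  move=> [|[|i]] iln; [apply: residual_le u0; nat_lia|apply: residual_le u1; nat_lia|].
  have -> : i.+2 = (n - (n - i.+2))%N by nat_lia.
  by apply: (@residual_le (n - i.+2)); [nat_lia|apply: desc; nat_lia].
case: dQ => /factors_ge => /(_ _ _)[]// dx dy.
- by apply: be_case => //; rewrite dy orbT.
- have u1 := u1_al dx.
  have u0 : `|u 0%N| <= D ^+ 2 * e.
    by apply: (@residual_step ga (- ga) (u 1%N)); rewrite ?normrN // mulNr.
  have u2 : `|u 2%N| <= D ^+ 3 * e.
    by apply: (@residual_step ga be (u 0%N)); rewrite // addrC.
  have asc k : (2 + k < n)%N -> `|u (2 + k)%N| <= D ^+ (3 + k) * e.
    elim: k => [//|k IHk] kn.
    rewrite !addnS; apply: (@residual_step al be (u (2 + k)%N)) => //; last first.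
      by apply: IHk; nat_lia.
    by rewrite addrC; apply: (ri (2 + k).+1); nat_lia.
  move=> [|[|i]] iln; [apply: residual_le u0; nat_lia|apply: residual_le u1; nat_lia|].
  by apply: (@residual_le (3 + i)); [nat_lia|exact: (asc i)].
- by apply: be_case => //; rewrite dx.
Qed.

End kernel_estimate.

(** * The three-parameter space of matrices and its action on vectors *)

Section pencil.
Context {R : realType}.

(* The combination [a V_a + b V_b + c V_c], with rows and columns counted from
   0; in each row [i >= 3] the coefficients [b], [a] stand in the columns
   [i - 1], [i].  Row [n] contains only [b], the rows below it vanish. *)
Definition pencil_coef (a b c : R) (i j : nat) : R :=
  match i with
  | 0%N => b *+ (j == 0%N) + c *+ (j == 2%N)
  | 1%N => c *+ (j == 0%N) - c *+ (j == 1%N)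
  | 2%N => a *+ (j == 1%N)
  | _ => b *+ (j.+1 == i) + a *+ (j == i)
  end.

Definition pencil (m n : nat) (a b c : R) : 'M[R]_(m, n) :=
  \matrix_(i, j) pencil_coef a b c i j.

(** Reading zero past the last index lets row [n] of the pencil obey the same recurrence as the rows
    above it, and supplies [u n = 0] in [residual_bound]. *)
Definition coord_ext (n : nat) (v : 'cV[R]_n) (k : nat) : R :=
  if insub k is Some j then v j 0 else 0.

Lemma coord_extE (n : nat) (v : 'cV[R]_n) (j : 'I_n) : coord_ext v j = v j 0.
Proof.
rewrite /coord_ext insubT // => jn; rewrite -[Sub _ _]/(Ordinal _).
by congr (v _ 0); exact: val_inj.
Qed.

Lemma coord_ext_ge (n : nat) (v : 'cV[R]_n) (k : nat) :
  (n <= k)%N -> coord_ext v k = 0.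
Proof. by move=> nk; rewrite /coord_ext insubF // ltnNge nk. Qed.

Lemma sum_coord (n : nat) (v : 'cV[R]_n) (k : nat) (x : R) :
  \sum_(j < n) (x *+ (j == k :> nat)) * v j 0 = x * coord_ext v k.
Proof.
have [kn|nk] := ltnP k n; last first.
  rewrite coord_ext_ge // mulr0 big1 // => j _.
  by rewrite (_ : (j == k :> nat) = false) ?mul0r //; have := ltn_ord j; lia.
rewrite (bigD1 (Ordinal kn)) //= eqxx mulr1n big1 ?addr0 => [|j jk].
  by rewrite -(coord_extE v (Ordinal kn)).
by rewrite -val_eqE /= in jk; rewrite (negbTE jk) mul0r.
Qed.

Lemma pencil_mul (m n : nat) (a b c : R) (v : 'cV[R]_n) (i : 'I_m) :
  (pencil m n a b c *m v) i 0 =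
  match val i with
  | 0%N => b * coord_ext v 0 + c * coord_ext v 2
  | 1%N => c * coord_ext v 0 - c * coord_ext v 1
  | 2%N => a * coord_ext v 1
  | _ => b * coord_ext v (val i).-1 + a * coord_ext v (val i)
  end.
Proof.
rewrite mxE; under eq_bigr do rewrite mxE.
case: i => -[|[|[|i]]] im /=; rewrite -!sum_coord -?sumrB -?big_split //=;
  by apply: eq_bigr => j _; rewrite ?mulrDl ?mulNr ?eqSS.
Qed.

Lemma pencilD (m n : nat) (a b c a' b' c' t : R) :
  pencil m n (a + t * a') (b + t * b') (c + t * c') =
  pencil m n a b c + t *: pencil m n a' b' c'.
Proof.
apply/matrixP => i j; rewrite !mxE; case: (val i) => [|[|[|k]]] /=;
  by rewrite !mulrnDl ?mulrBr ?mulrDr ?mulrnAr ?opprD 1?addrACA.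
Qed.

Lemma pencil_lin (m n : nat) (a b c : R) :
  pencil m n a b c =
  a *: pencil m n 1 0 0 + b *: pencil m n 0 1 0 + c *: pencil m n 0 0 1.
Proof.
apply/matrixP => i j; rewrite !mxE; case: (val i) => [|[|[|k]]] /=;
  rewrite ?mul0rn ?add0r ?addr0 ?oppr0 ?addr0 ?mulr0 ?mulr_natr
    ?add0r ?addr0 ?mulrBr ?mulr_natr //.
by rewrite addrC.
Qed.

End pencil.

(** * The integrand and its convexity in singular directions *)

Section integrand.
Context {R : realType}.
Variables (m n : nat).
Hypothesis nm : (n <= m)%N.
Local Notation mat := 'M[R]_(m.+4, n.+3).

(* Linear functionals reading off [a], [b], [c] on the pencil. *)
Definition pa (A : mat) : R := A (inord 2) (inord 1).
Definition pb (A : mat) : R := A ord0 ord0.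
Definition pc (A : mat) : R := A ord0 (inord 2).

Definition remainder (A : mat) : mat := A - pencil _ _ (pa A) (pb A) (pc A).

Definition sqnorm (A : mat) : R := \sum_i \sum_j (A i j) ^+ 2.

Lemma sqnorm_ge0 (A : mat) : 0 <= sqnorm A.
Proof. by apply: sumr_ge0 => i _; apply: sumr_ge0 => j _; exact: sqr_ge0. Qed.

Lemma entry_le_sqnorm (A : mat) i j : `|A i j| <= Num.sqrt (sqnorm A).
Proof.
rewrite -sqrtr_sqr ler_wsqrtr // /sqnorm (bigD1 i) //= (bigD1 j) //= -addrA.
rewrite lerDl addr_ge0 //; first by apply: sumr_ge0 => k _; exact: sqr_ge0.
by apply: sumr_ge0 => k _; apply: sumr_ge0 => l _; exact: sqr_ge0.
Qed.

Lemma singular_kernel (V : mat) : (\rank V <= n.+2)%N ->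
  exists2 v : 'cV[R]_n.+3, v != 0 & V *m v = 0.
Proof.
move=> rV; have : kermx V^T != 0.
  by rewrite kermx_eq0 /row_free mxrank_tr; lia.
case/rowV0Pn => u /sub_kermxP uV u0; exists u^T.
  by apply: contraNneq u0 => /(congr1 trmx); rewrite trmxK trmx0 => ->.
by apply: trmx_inj; rewrite trmx_mul trmxK uV trmx0.
Qed.

(** On the kernel of [V] the pencil part acts as minus the remainder, so a small remainder makes [v]
    an approximate kernel vector of the pencil part. *)
Lemma remainder_kernel (V : mat) (v : 'cV[R]_n.+3) (N : R) (i : 'I_m.+4) :
  V *m v = 0 -> (forall j, `|v j 0| <= N) ->
  `|(pencil m.+4 n.+3 (pa V) (pb V) (pc V) *m v) i 0| <=
  n.+3%:R * Num.sqrt (sqnorm (remainder V)) * N.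
Proof.
move=> Vv vN.
have -> : pencil m.+4 n.+3 (pa V) (pb V) (pc V) *m v = - (remainder V *m v).
  by rewrite mulmxBl Vv sub0r opprK.
rewrite mxE normrN mxE (le_trans (ler_norm_sum _ _ _)) //.
have -> : n.+3%:R * Num.sqrt (sqnorm (remainder V)) * N =
    \sum_(j < n.+3) (Num.sqrt (sqnorm (remainder V)) * N).
  by rewrite sumr_const card_ord -mulrA mulr_natl.
apply: ler_sum => j _; rewrite normrM ler_pM //.
exact: entry_le_sqnorm.
Qed.

(** The growth factor of [residual_bound] times the number of columns from [remainder_kernel],
    squared because [sqnorm] is a squared norm. *)
Definition gap_const (d : R) : R := ((2 / d) ^+ (n.+3 + 3) * n.+3%:R) ^+ 2.

(** After division of the coefficients by sqrt W, [residual_bound] applies to a kernel vector of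
    [V]. At its largest entry, of size N, it bounds N by a multiple of N
    sqrt([sqnorm (remainder V)]) / sqrt W. Cancelling N and squaring gives the claim. *)
Lemma singular_gap (d : R) (V : mat) (al := pa V) (be := pb V) (ga := pc V)
    (W := al ^+ 2 + be ^+ 2 + ga ^+ 2) :
  0 < d -> d <= 1 -> (\rank V <= n.+2)%N -> 0 < W ->
  [\/ d * W <= `|be * ga|, d * W <= `|al * ga| | d * W <= `|al * be| ] ->
  W <= gap_const d * sqnorm (remainder V).
Proof.
move=> d0 d1 rV W0 dQ; have [v v0 Vv] := singular_kernel rV.
pose k := [arg max_(j > ord0) `|v j 0|]%O.
have vk j : `|v j 0| <= `|v k 0|.
  by rewrite /k; case: arg_maxP => //= i _; apply.
have N0 : 0 < `|v k 0|.
  rewrite lt_neqAle normr_ge0 andbT; apply: contraNneq v0 => vk0.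
  apply/eqP/matrixP => j l; rewrite ord1 mxE; apply/eqP.
  by rewrite -normr_le0 vk0.
set N := `|v k 0| in vk N0.
set tau := Num.sqrt (sqnorm (remainder V)).
set h := Num.sqrt W; have h0 : 0 < h by rewrite sqrtr_gt0.
have hW : h * h = W by rewrite -expr2 sqr_sqrtr // ltW.
have le_h (x : R) : x ^+ 2 <= W -> `|h^-1 * x| <= 1.
  move=> xW; rewrite normrM normfV (gtr0_norm h0) ler_pdivrMl // mulr1.
  by rewrite -sqrtr_sqr ler_wsqrtr.
have al1 : `|h^-1 * al| <= 1 by apply: le_h; rewrite /W -addrA lerDl addr_ge0 ?sqr_ge0.
have be1 : `|h^-1 * be| <= 1 by apply: le_h; rewrite /W addrAC lerDr addr_ge0 ?sqr_ge0.
have ga1 : `|h^-1 * ga| <= 1 by apply: le_h; rewrite /W lerDr addr_ge0 ?sqr_ge0.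
have prod_h (x y : R) : d * W <= `|x * y| -> d <= `|h^-1 * x * (h^-1 * y)|.
  by move=> dW; rewrite mulrACA normrM -invfM hW normfV (gtr0_norm W0)
    ler_pdivlMl // mulrC.
pose e := h^-1 * (n.+3%:R * tau * N).
have e0 : 0 <= e by rewrite !mulr_ge0 ?invr_ge0 ?sqrtr_ge0 // ltW.
have row (i : 'I_m.+4) (x : R) :
    (pencil m.+4 n.+3 al be ga *m v) i 0 = x -> `|h^-1 * x| <= e.
  move=> <-; rewrite normrM normfV (gtr0_norm h0) ler_pM2l ?invr_gt0 //.
  exact: remainder_kernel.
have : `|coord_ext v k| <= (2 / d) ^+ (n.+3 + 3) * e.
  apply: (@residual_bound R d e d0 d1 e0 n.+3 (h^-1 * al) (h^-1 * be) (h^-1 * ga)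
    (coord_ext v)) => //.
  - case: dQ => dQ; [apply: Or31|apply: Or32|apply: Or33]; exact: prod_h.
  - exact: coord_ext_ge.
  - by rewrite -!mulrA -mulrDr; apply: (row ord0); rewrite pencil_mul.
  - by rewrite -!mulrA -mulrBr; apply: (row (Ordinal (isT : 1 < m.+4)%N)); rewrite pencil_mul.
  - by rewrite -!mulrA; apply: (row (Ordinal (isT : 2 < m.+4)%N)); rewrite pencil_mul.
  move=> [|[|[|i]]] // /andP[_ i_n].
  (* The rows used go up to index [n.+3], one past the last column index plus one row of slack for
     [b] alone; here at least one more row than columns is required. *)
  have im : (i.+3 < m.+4)%N by rewrite ltnS (leq_trans i_n).
  by rewrite -!mulrA -mulrDr; apply: (row (Ordinal im)); rewrite pencil_mul.
rewrite coord_extE -/N /e.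
have -> : (2 / d) ^+ (n.+3 + 3) * (h^-1 * (n.+3%:R * tau * N)) =
  (2 / d) ^+ (n.+3 + 3) * (h^-1 * (n.+3%:R * tau)) * N by rewrite !mulrA.
rewrite ler_pMl // mulrCA ler_pdivlMl // mulr1 mulrA => hC.
rewrite -(sqr_sqrtr (sqnorm_ge0 _)) -/tau -exprMn -hW -expr2.
by rewrite ler_pXn2r // nnegrE ?(ltW h0) // (le_trans (ltW h0)).
Qed.

(** Either a product is below d W, or [singular_gap] bounds W, hence the product, by the remainder
    term. The value of d solves 225 d = 1 / 100, as [trilinear_bound] demands. *)
Lemma singular_products (V : mat) (al := pa V) (be := pb V) (ga := pc V)
    (W := al ^+ 2 + be ^+ 2 + ga ^+ 2)
    (B := (100 * 225)^-1 * W + gap_const ((100 * 225)^-1) * sqnorm (remainder V)) :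
  (\rank V <= n.+2)%N ->
  [/\ `|be * ga| <= B, `|al * ga| <= B & `|al * be| <= B].
Proof.
move=> rV; pose C := gap_const ((100 * 225)^-1) * sqnorm (remainder V).
have d0 : 0 < (100 * 225)^-1 :> R by rewrite invr_gt0 mulr_gt0.
have d1 : (100 * 225)^-1 <= 1 :> R by rewrite invf_le1 ?mulr_gt0 // mulr_ege1 ?ler1n.
have C0 : 0 <= C by rewrite mulr_ge0 ?sqr_ge0 ?sqnorm_ge0.
have W0 : 0 <= W by rewrite !addr_ge0 ?sqr_ge0.
have bgW : `|be * ga| <= W / 2.
  by apply: norm_mul_le_half; rewrite /W -addrA lerDr sqr_ge0.
have agW : `|al * ga| <= W / 2.
  by apply: norm_mul_le_half; rewrite /W addrAC lerDl sqr_ge0.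
have abW : `|al * be| <= W / 2.
  by apply: norm_mul_le_half; rewrite /W lerDl sqr_ge0.
suff main x : 0 <= x -> x <= W / 2 -> (0 < W -> (100 * 225)^-1 * W <= x -> W <= C) -> x <= B.
  split; apply: main => // Wgt0 dW; apply: singular_gap => //.
  - exact: Or31.
  - exact: Or32.
  - exact: Or33.
move=> x0 xW gap; rewrite /B -/C; have [dW|/ltW xd] := leP ((100 * 225)^-1 * W) x; last first.
  by rewrite (le_trans xd) // lerDl.
have [W_le0|Wgt0] := leP W 0.
  by apply: (le_trans xW); lra.
by have := gap Wgt0 dW; lra.
Qed.

(** The factor 1 / 100 is small enough to keep the average along the field negative, where S <= 3
    and so (S + S^2) / 100 <= 12 / 100 < 1 / 4. The last coefficient is the one produced by
    [trilinear_bound]. *)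
Definition integrand (A : mat) : R :=
  let S := pa A ^+ 2 + pb A ^+ 2 + pc A ^+ 2 in
  - (pa A * pb A * pc A) + (S + S ^+ 2) / 100 +
  225 * gap_const ((100 * 225)^-1) * sqnorm (remainder A).

Lemma remainder_line (A V : mat) (t : R) :
  remainder (A + t *: V) = remainder A + t *: remainder V.
Proof.
rewrite /remainder /pa /pb /pc !mxE pencilD scalerBr; set P := pencil _ _ _ _ _.
by rewrite opprD addrACA.
Qed.

(** Convexity depends on the quadratic coefficient, so the linear one stays existential. *)
Lemma sqnorm_line (A V : mat) : exists x, forall t : R,
  sqnorm (A + t *: V) = sqnorm A + x * t + sqnorm V * t ^+ 2.
Proof.
exists (\sum_i \sum_j 2 * (A i j * V i j)) => t.
rewrite /sqnorm !mulr_suml -!big_split; apply: eq_bigr => i _ /=.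
rewrite !mulr_suml -!big_split; apply: eq_bigr => j _ /=.
by rewrite !mxE; ring.
Qed.

Lemma integrand_rank_convex : rank_convex n.+2 integrand.
Proof.
move=> A V rV; have [x sqE] := sqnorm_line (remainder A) (remainder V).
set K := 225 * gap_const ((100 * 225)^-1).
have [] := singular_products rV.
set al := pa V; set be := pb V; set ga := pc V; set W := _ + _ + _.
set tau2 := sqnorm (remainder V) => hbg hag hab.
set a := pa A; set b := pb A; set c := pc A.
pose S := a ^+ 2 + b ^+ 2 + c ^+ 2; pose s := a * al + b * be + c * ga.
have -> : (fun t => integrand (A + t *: V)) = (fun t =>
    (- (a * b * c) + (S + S ^+ 2) / 100 + K * sqnorm (remainder A)) +
    (- (a * b * ga + a * be * c + al * b * c) + (2 * s + 4 * S * s) / 100 + K * x) * t +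
    (- (a * (be * ga) + b * (al * ga) + c * (al * be)) +
      (W + 2 * S * W + 4 * s ^+ 2) / 100 + K * tau2) * t ^+ 2 +
    (- (al * be * ga) + 4 * s * W / 100) * t ^+ 3 + W ^+ 2 / 100 * t ^+ 4).
  apply/funext => t; rewrite /integrand remainder_line sqE.
  have -> : pa (A + t *: V) = a + t * al by rewrite /pa !mxE.
  have -> : pb (A + t *: V) = b + t * be by rewrite /pb !mxE.
  have -> : pc (A + t *: V) = c + t * ga by rewrite /pc !mxE.
  by rewrite -/K -/tau2 /S /s /W; field.
apply: quartic_convex => t.
have dE : 225 * (100 * 225)^-1 = 100^-1 :> R by field.
have C0 : 0 <= gap_const ((100 * 225)^-1) by exact: sqr_ge0.
(* Half the second derivative at [t] is that at 0 for the base point [A + t *: V], whence the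
   shifted coordinates. *)
have := trilinear_bound (a + t * al) (b + t * be) (c + t * ga) (sqnorm_ge0 _) C0 dE hbg hag hab.
rewrite -/W -/tau2 -/K -subr_ge0 => H.
(* The square left over from [S ^+ 2]: [s + W * t] is half the derivative of S along the line. *)
have : 0 <= 4 * (s + W * t) ^+ 2 / 100 by rewrite mulr_ge0 ?invr_ge0 // mulr_ge0 // sqr_ge0.
move/(addr_ge0 H); congr (0 <= _); by rewrite /S /s /W; field.
Qed.

End integrand.

(** * The solenoidal field *)

Section classC_closure.
Context {R : realType} {n : nat} {W : normedModType R}.

Lemma classCD (k : nat) (f g : 'rV[R]_n -> W) :
  classC k f -> classC k g -> classC k (f + g).
Proof.
elim: k f g => [|k IHk] f g /=.
  by move=> cf cg x; exact: cvgD (cf x) (cg x).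
move=> [cf df] [cg dg]; split.
  by move=> x; exact: cvgD (cf x) (cg x).
move=> j; have [df1 df2] := df j; have [dg1 dg2] := dg j; split.
  by move=> x; exact: derivableD.
rewrite (_ : (fun x => _) = (fun x => 'D_(basis_vec j) f x) + (fun x => 'D_(basis_vec j) g x)).
  exact: IHk.
by apply/funext => x; rewrite deriveD.
Qed.

End classC_closure.

(** * Plane waves and their derivatives *)

Section plane_waves.
Context {R : realType} {n : nat} {W : normedModType R}.
Implicit Types (x v kappa : 'rV[R]_n) (p q s : R) (V : W).

Definition dot kappa x : R := \sum_j kappa 0 j * x 0 j.

Lemma dotD kappa x v : dot kappa (x + v) = dot kappa x + dot kappa v.
Proof. by rewrite /dot -big_split; apply: eq_bigr => j _; rewrite mxE mulrDr. Qed.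

Lemma dotZ kappa h v : dot kappa (h *: v) = h * dot kappa v.
Proof. by rewrite /dot mulr_sumr; apply: eq_bigr => j _; rewrite mxE mulrCA. Qed.

Lemma dot_basis kappa (j : 'I_n) : dot kappa (basis_vec j) = kappa 0 j.
Proof.
rewrite /dot (bigD1 j) //= big1 => [|i ij]; first by rewrite mxE !eqxx mulr1 addr0.
by rewrite mxE eqxx (negbTE ij) mulr0.
Qed.

Lemma continuous_dot kappa : continuous (dot kappa).
Proof.
apply: continuous_big => [|j _]; first exact: add_continuous.
move=> x; exact: (cvgMl_tmp (@coord_continuous R 1 n 0 j x)).
Qed.

(** The difference quotient of the composite is exactly that of [g] at [dot kappa x] in the
    direction [dot kappa v]. *)
Lemma is_derive_comp_dot (g : R -> W) kappa x v : derivable g (dot kappa x) 1 ->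
  is_derive x v (g \o dot kappa) (dot kappa v *: g^`()%classic (dot kappa x)).
Proof.
move=> /derivable1_diffP dg.
have quotE : (fun h : R => h^-1 *: ((g \o dot kappa \o shift x) (h *: v) - (g \o dot kappa) x)) =
    (fun h => h^-1 *: ((g \o shift (dot kappa x)) (h *: dot kappa v) - g (dot kappa x))).
  by apply/funext => h /=; rewrite dotD dotZ.
apply: DeriveDef.
  rewrite /derivable quotE; exact: diff_derivable.
rewrite /derive quotE -[LHS]/('D_(dot kappa v) g (dot kappa x)) deriveE //.
by rewrite diff1E.
Qed.

(** The span of cosine and sine is stable under differentiation, so every partial derivative of a
    wave is again a wave; smoothness follows by induction. *)
Definition trig p q s : R := p * cos s + q * sin s.

Lemma is_derive_trig p q s : is_derive s 1 (trig p q) (trig q (- p) s).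
Proof.
rewrite (_ : trig p q = p \*: cos + q \*: sin); last by apply/funext.
apply: is_derive_eq.
by rewrite /trig /GRing.scale /=; ring.
Qed.

Definition wave kappa p q V x : W := trig p q (dot kappa x) *: V.

Lemma is_derive_wave kappa p q V x v :
  is_derive x v (wave kappa p q V) (dot kappa v *: wave kappa q (- p) V x).
Proof.
have dt s : differentiable (trig p q) s.
  by apply/derivable1_diffP; have [] := is_derive_trig p q s.
have dg s : differentiable (fun s => trig p q s *: V) s.
  exact: differentiableZl.
have := @is_derive_comp_dot (fun s => trig p q s *: V) kappa x v.
rewrite derive1E' // diffZl // -derive1E' // derive1E.
have [_ ->] := is_derive_trig p q (dot kappa x).
by apply; apply/derivable1_diffP.
Qed.

Lemma continuous_wave kappa p q V : continuous (wave kappa p q V).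
Proof.
move=> x; apply: (@continuous_comp _ _ _ (dot kappa) (fun s => trig p q s *: V)).
  exact: continuous_dot.
apply: cvgZr_tmp; apply: differentiable_continuous; apply/derivable1_diffP.
by have [] := is_derive_trig p q (dot kappa x).
Qed.

Lemma classC_wave (k : nat) kappa p q V : classC k (wave kappa p q V).
Proof.
elim: k p q V => [|k IHk] p q V /=; first exact: continuous_wave.
split=> [|j]; first exact: continuous_wave.
split=> [x|]; first by have [] := is_derive_wave kappa p q V x (basis_vec j).
rewrite (_ : (fun x => _) = wave kappa q (- p) (kappa 0 j *: V)); first exact: IHk.
apply/funext => x; have [_ ->] := is_derive_wave kappa p q V x (basis_vec j).
by rewrite dot_basis /wave !scalerA mulrC.
Qed.

End plane_waves.

Section solenoidal_field.
Context {R : realType}.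
Variables (m n : nat).

(** The pairs (true, false), (false, true), (true, true) give the resonant frequencies 2 pi e_0, 2
    pi e_1 and their sum. *)
Definition freq (p q : bool) : 'rV[R]_n.+3 :=
  \row_j (2 * pi *+ ((p && (val j == 0%N)) || (q && (val j == 1%N)))).

Lemma dot_freq p q (x : 'rV[R]_n.+3) :
  dot (freq p q) x = 2 * pi * (x 0 ord0 *+ p + x 0 (lift ord0 ord0) *+ q).
Proof.
rewrite /dot !big_ord_recl big1 => [|i _]; last first.
  by rewrite mxE /= !andbF mul0r.
rewrite !mxE /= !andbF orbF addr0 !andbT.
by case: p; case: q; rewrite ?mulr0n ?mulr1n; ring.
Qed.

Lemma coord_ext_freq p q k :
  coord_ext (freq p q)^T k = 2 * pi *+ ((p && (k == 0%N)) || (q && (k == 1%N))).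
Proof.
have [kn|nk] := ltnP k n.+3.
  by rewrite -[k]/(val (Ordinal kn)) coord_extE !mxE.
by rewrite coord_ext_ge //; case: k nk => [|[|k]] // _; rewrite !andbF.
Qed.

Definition field (x : 'rV[R]_n.+3) : 'M[R]_(m.+4, n.+3) :=
  pencil _ _ (cos (dot (freq true false) x)) (cos (dot (freq false true) x))
    (cos (dot (freq true true) x)).

Lemma field_waves :
  field = wave (freq true false) 1 0 (pencil _ _ 1 0 0) +
    wave (freq false true) 1 0 (pencil _ _ 0 1 0) +
    wave (freq true true) 1 0 (pencil _ _ 0 0 1).
Proof.
have trigE (s : R) : trig 1 0 s = cos s by rewrite /trig mul1r mul0r addr0.
by apply/funext => x; rewrite /field pencil_lin -!trigE.
Qed.

Lemma field_smooth : smooth field.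
Proof.
by move=> k; rewrite field_waves; do 2?apply: classCD; exact: classC_wave.
Qed.

Lemma field_periodic : periodic_field field.
Proof.
move=> x j.
have cosE p q : cos (dot (freq p q) (x + basis_vec j)) = cos (dot (freq p q) x).
  rewrite dotD dot_basis mxE; case: (_ || _); last by rewrite mulr0n addr0.
  by rewrite mulr1n mulr_natl cosD2pi.
by rewrite /field !cosE.
Qed.

(** Each wave has divergence a scalar times its matrix applied to its frequency. Column 0 of V_a and
    column 1 of V_b vanish, and columns 0 and 1 of V_c cancel. *)
Lemma field_Div x : Div field x = 0.
Proof.
have dw p q (V : 'M[R]_(m.+4, n.+3)) v := is_derive_wave (freq p q) 1 0 V x v.
pose w p q := @wave R _ 'M[R]_(m.+4, n.+3) (freq p q) 0 (- 1).
have dB v : is_derive x v field (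
    dot (freq true false) v *: w true false (pencil _ _ 1 0 0) x +
    dot (freq false true) v *: w false true (pencil _ _ 0 1 0) x +
    dot (freq true true) v *: w true true (pencil _ _ 0 0 1) x).
  rewrite field_waves.
  exact: is_deriveD (is_deriveD (dw true false _ v) (dw false true _ v)) (dw true true _ v).
apply/matrixP => i k; rewrite [RHS]mxE mxE {k}.
have freq_kernel p q a b c :
    (forall i : 'I_m.+4, (pencil m.+4 n.+3 a b c *m (freq p q)^T) i 0 = 0) ->
    \sum_j (dot (freq p q) (basis_vec j) *: w p q (pencil _ _ a b c) x) i j = 0.
  move=> /(_ i) ker; rewrite /w /wave; set z := trig _ _ _.
  rewrite -[RHS](mulr0 z) -[X in z * X]ker [X in z * X]mxE mulr_sumr.
  apply: eq_bigr => j _; rewrite dot_basis scalerA [LHS]mxE -mulrA mulrCA.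
  by rewrite [(freq p q)^T _ _]mxE [X in z * X]mulrC.
transitivity (\sum_j
    ((dot (freq true false) (basis_vec j) *: w true false (pencil _ _ 1 0 0) x +
    dot (freq false true) (basis_vec j) *: w false true (pencil _ _ 0 1 0) x +
    dot (freq true true) (basis_vec j) *: w true true (pencil _ _ 0 0 1) x) i j)).
  apply: eq_bigr => j _; have [dj <-] := dB (basis_vec j).
  by rewrite derive_mx // mxE.
under eq_bigr do rewrite mxE [X in X + _]mxE.
rewrite !big_split /= !freq_kernel ?addr0 // => k; rewrite pencil_mul;
  case: (val k) => [|[|[|l]]]; rewrite !coord_ext_freq /= ?andbF ?orbF //=;
  rewrite ?mulr0n ?mulr1n ?mul0r ?mulr0 ?addr0 ?subrr //.
Qed.

End solenoidal_field.

(** * Integration over the cube *)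

Section cube_integrals.
Local Open Scope classical_set_scope.
Local Open Scope ring_scope.
Context {R : realType}.
Local Notation leb := (@lebesgue_measure R).
Local Notation mu n := (@lebesgue_tuple R n).

Local Notation I01 := (`]0%R, 1%R[%classic : set (measurableTypeR R)).

Lemma leb01 : leb I01 = 1%E.
Proof. by rewrite [LHS]lebesgue_measure_itv /= lte_fin ltr01 oppr0 adde0. Qed.

Definition cube n : set (@tupleR R n) := [set t | forall i, tnth t i \in `]0, 1[].

Lemma measurable_box n (A : 'I_n -> set (measurableTypeR R)) :
  (forall i, measurable (A i)) ->
  measurable [set t : @tupleR R n | forall i, A i (tnth t i)].
Proof.
move=> mA; rewrite (_ : mkset _ =
    \bigcap_(i in [set: 'I_n]) ((@tnth n _) ^~ i @^-1` A i)).
  apply: fin_bigcap_measurable => // i _.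
  by rewrite -[X in measurable X]setTI; exact: measurable_tnth.
by apply/seteqP; split=> t /= At i; [move=> _|]; exact: At.
Qed.

Lemma measurable_cube n : measurable (@cube n).
Proof.
have := @measurable_box n (fun=> `]0, 1[%classic) (fun=> measurable_itv _).
by [].
Qed.

Lemma lebesgue_cube n : mu n (cube (n := n)) = 1%E.
Proof.
rewrite [LHS](@lebesgue_tuple_box R n (fun=> `]0, 1[%classic)) => [|i]; last exact: measurable_itv.
by rewrite big1 // => i _; exact: leb01.
Qed.

Lemma sigma_finite_lebesgue_tuple n : sigma_finite [set: @tupleR R n] (mu n).
Proof.
exists (fun k => [set t | forall i, `[(- k%:R), k%:R]%classic (tnth t i)]).
  (* The sum of the absolute values bounds every coordinate, so [t] lies in the box of any larger
     half-width. *)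
  apply/esym/seteqP; split=> // t _; pose b := \sum_i `|tnth t i|.
  have b0 : 0 <= b by apply: sumr_ge0.
  exists (Num.truncn b).+1 => // i /=; rewrite in_itv /= -ler_norml.
  rewrite (le_trans _ (ltW (truncnS_gt b))) // /b (bigD1 i) //= lerDl.
  exact: sumr_ge0.
move=> k; split; first exact: (@measurable_box n
    (fun=> `[- k%:R, k%:R]%classic) (fun=> measurable_itv _)).
rewrite (lebesgue_tuple_box (A := fun=> `[- k%:R, k%:R]%classic)) => [|i]; last first.
  exact: measurable_itv.
rewrite ltey_eq; apply/orP; left.
elim/big_ind : _ => // [x y|i _]; first exact: fin_numM.
by rewrite lebesgue_measure_itv /=; case: ifP.
Qed.

(* A copy of [mu n] that can carry the sigma-finite structure required by
   Fubini's theorem. *)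
Definition sf_mu n : set (@tupleR R n) -> \bar R := mu n.

HB.instance Definition _ n := Measure.copy (@sf_mu n) (mu n).

HB.instance Definition _ n :=
  Measure_isSigmaFinite.Build _ _ _ (@sf_mu n) (@sigma_finite_lebesgue_tuple n).

(** A class stable under sums and products whose members are integrable on the cube; all
    integrability side conditions reduce to it. *)
Definition bounded_measurable d (T : measurableType d) (f : T -> R) :=
  measurable_fun setT f /\ exists M, forall x, `|f x| <= M.

Lemma bounded_measurable_integrable d (T : measurableType d)
    (nu : {measure set T -> \bar R}) (A : set T) (f : T -> R) :
  measurable A -> (nu A < +oo)%E -> bounded_measurable f ->
  nu.-integrable A (EFin \o f).
Proof.
move=> mA nuA [mf [M fM]]; apply: measurable_bounded_integrable => //.
  exact: measurable_funTS.
exists M; split; rewrite ?num_real // => N MN x _ /=.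
exact: le_trans (fM x) (ltW MN).
Qed.

Lemma cube_integrable n (f : @tupleR R n -> R) :
  bounded_measurable f -> (mu n).-integrable (@cube n) (EFin \o f).
Proof.
move=> bf; apply: bounded_measurable_integrable => //; first exact: measurable_cube.
by rewrite [X in (X < _)%E]lebesgue_cube ltry.
Qed.

(** Separation of the first coordinate: the measure is the image under [consR] of a product measure,
    the cube pulls back to a product set, and Fubini's theorem applies. *)
Lemma cube_integral_cons n (f : @tupleR R n.+1 -> R) (h : @tupleR R n -> R)
    (p : R -> R) :
  bounded_measurable f -> bounded_measurable h ->
  bounded_measurable (p : measurableTypeR R -> R) ->
  (forall s x, f (consR (s, x)) = h s * p x) ->
  \int[mu n.+1]_(t in @cube n.+1) f t =
  (\int[mu n]_(t in @cube n) h t) * \int[leb]_(x in I01) p x.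
Proof.
move=> bf bh bp fE.
have cubeE : @consR R n @^-1` @cube n.+1 = @cube n `*` I01.
  apply/seteqP; split=> -[t x] /=.
    move=> tx; split; last by have := tx ord0; rewrite tnth0.
    by move=> i; have := tx (lift ord0 i); rewrite tnthS.
  move=> [tc xc] i; case: (unliftP ord0 i) => [j|] ->; last by rewrite tnth0.
  by rewrite tnthS.
have mC : measurable (@cube n `*` I01).
  by apply: measurableX; [exact: measurable_cube|exact: measurable_itv].
have C_fin : ((mu n \x leb) (@cube n `*` I01) < +oo)%E.
  rewrite product_measure1E; [|exact: measurable_cube|exact: measurable_itv].
  by rewrite [X in (X * _)%E]lebesgue_cube mul1e [X in (X < _)%E]leb01 ltry.
have bfc : bounded_measurable (f \o @consR R n).
  have [mf [M fM]] := bf; split; last by exists M => x; exact: fM.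
  by apply: measurableT_comp mf _; exact: measurable_consR.
have int_fc : (mu n \x leb)%E.-integrable (@cube n `*` I01) (EFin \o (f \o @consR R n)).
  exact: (bounded_measurable_integrable mC C_fin bfc).
have int_h := cube_integrable bh.
have int_p : leb.-integrable I01 (EFin \o p).
  apply: bounded_measurable_integrable => //.
  by rewrite [X in (X < _)%E]leb01 ltry.
rewrite /Rintegral -fineM; [|exact: (integrable_fin_num (@measurable_cube n) int_h)
  |exact: (integrable_fin_num _ int_p)].
congr fine.
transitivity (\int[mu n \x leb]_(x in @cube n `*` I01) ((f \o @consR R n) x)%:E)%E.
  rewrite -cubeE; apply: (@integral_pushforward _ _ _ _ _ _ (measurable_consR (R := R) (n := n))).
  - by apply/measurable_EFinP; case: bf.
  - by rewrite cubeE.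
  - exact: measurable_cube.
(* Fubini's theorem is used on the whole space, for functions extended by zero. *)
rewrite [LHS]integral_mkcond.
have int_fcD := (integrable_mkcond (EFin \o (f \o @consR R n)) mC).1 int_fc.
apply: etrans (esym (@integral12_prod_meas1 _ _ _ _ R (@sf_mu n) leb _ int_fcD)) _.
have mI : measurable I01 by exact: measurable_itv.
have fin_p := integrable_fin_num mI int_p.
rewrite [X in (X * _)%E]integral_mkcond -[X in (_ * X)%E](fineK fin_p).
have int_hD := (integrable_mkcond _ (@measurable_cube n)).1 int_h.
apply: etrans (integralZr measurableT int_hD _).
apply: eq_integral => s _; rewrite (fineK fin_p) /fubini_F [X in (X * _)%E]patchE.
have [sc|sc] := boolP (s \in @cube n); last first.
  rewrite mul0e; apply: integral0_eq => y _.
  by rewrite patchE in_setX (negbTE sc).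
rewrite -(integralZl _ int_p) // [RHS]integral_mkcond.
apply: eq_integral => y _; rewrite !patchE in_setX sc /=.
by case: ifP => _ //; rewrite fE EFinM.
Qed.

End cube_integrals.

Section bounded_measurable_closure.
Local Open Scope classical_set_scope.
Local Open Scope ring_scope.
Context {R : realType} {d : measure_display} {T : measurableType d}.
Implicit Types f g : T -> R.

Lemma bounded_measurable_cst (r : R) : bounded_measurable (fun _ : T => r).
Proof. by split; [exact: measurable_cst|exists `|r|]. Qed.

Lemma bounded_measurableD f g : bounded_measurable f -> bounded_measurable g ->
  bounded_measurable (fun x => f x + g x).
Proof.
move=> [mf [M fM]] [mg [N gN]]; split; first exact: measurable_funD.
by exists (M + N) => x; rewrite (le_trans (ler_normD _ _)) // lerD.
Qed.

Lemma bounded_measurableM f g : bounded_measurable f -> bounded_measurable g ->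
  bounded_measurable (fun x => f x * g x).
Proof.
move=> [mf [M fM]] [mg [N gN]]; split; first exact: measurable_funM.
by exists (M * N) => x; rewrite normrM ler_pM.
Qed.

Lemma bounded_measurableN f : bounded_measurable f ->
  bounded_measurable (fun x => - f x).
Proof.
move=> /(bounded_measurableM (bounded_measurable_cst (- 1))).
by congr bounded_measurable; apply/funext => x; rewrite mulN1r.
Qed.

End bounded_measurable_closure.

(** * Trigonometric integrals over the unit interval and the cube *)

Section trigonometric_integrals.
Local Open Scope classical_set_scope.
Local Open Scope ring_scope.
Context {R : realType}.
Local Notation leb := (@lebesgue_measure R).
Local Notation mu n := (@lebesgue_tuple R n).
Local Notation I01 := (`]0%R, 1%R[%classic : set (measurableTypeR R)).
Local Notation I p := (\int[leb]_(x in I01) p x).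
Local Notation J n f := (\int[mu n]_(t in @cube R n) f t).

(** The endpoints are null, so the fundamental theorem on the closed interval carries over. *)
Lemma unit_interval_FTC (f F : R -> R) :
  continuous f -> (forall x : R, is_derive x 1 F (f x)) -> I f = F 1 - F 0.
Proof.
move=> cf dF; have cF : continuous F.
  by move=> x; apply: differentiable_continuous; apply/derivable1_diffP; have [] := dF x.
have intf : leb.-integrable `[0, 1] (EFin \o f).
  apply: continuous_compact_integrable; first exact: segment_compact.
  exact: continuous_subspaceT.
rewrite [LHS](Rintegral_itv_obnd_cbnd (b := BLeft 1) (r := 0)); last first.
  by apply: integrableS intf => //; apply: subset_itv; rewrite bnd_simp.
rewrite Rintegral_itv_bndo_bndc; last first.
  by apply: integrableS intf => //; apply: subset_itv; rewrite bnd_simp.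
rewrite /Rintegral (@continuous_FTC2 _ _ F) //.
- exact: continuous_subspaceT.
- split=> [x _||]; first by have [] := dF x.
    exact: cvg_at_right_filter (cF 0).
  exact: cvg_at_left_filter (cF 1).
- by move=> x _; rewrite derive1E; have [_ ->] := dF x.
Qed.

(** The 2 refers to the factor 2 pi, not to a square. *)
Definition cos2 (x : R) := cos (2 * pi * x).
Definition sin2 (x : R) := sin (2 * pi * x).

Let w_neq0 : 2 * pi != 0 :> R.
Proof. by rewrite mulf_neq0 // gt_eqF // pi_gt0. Qed.

Lemma is_derive_cos2 (x : R) : is_derive x 1 cos2 (- (2 * pi) * sin2 x).
Proof.
have dl : is_derive x 1 ((2 * pi) \*: (id : R -> R)) ((2 * pi) *: 1) by exact: is_deriveZ.
have dc := @is_derive1_comp R cos ((2 * pi) \*: id) x _ _ (is_derive_cos _) dl.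
apply: is_derive_eq dc _; by rewrite /sin2 /GRing.scale /= mulr1 mulrC; ring.
Qed.

Lemma is_derive_sin2 (x : R) : is_derive x 1 sin2 (2 * pi * cos2 x).
Proof.
have dl : is_derive x 1 ((2 * pi) \*: (id : R -> R)) ((2 * pi) *: 1) by exact: is_deriveZ.
have dc := @is_derive1_comp R sin ((2 * pi) \*: id) x _ _ (is_derive_sin _) dl.
apply: is_derive_eq dc _; by rewrite /cos2 /GRing.scale /= mulr1 mulrC.
Qed.

Lemma continuous_cos2 : continuous cos2.
Proof.
move=> x; apply: differentiable_continuous; apply/derivable1_diffP.
by have [] := is_derive_cos2 x.
Qed.

Lemma continuous_sin2 : continuous sin2.
Proof.
move=> x; apply: differentiable_continuous; apply/derivable1_diffP.
by have [] := is_derive_sin2 x.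
Qed.

Lemma cos2_01 : (cos2 0 = 1) * (cos2 1 = 1).
Proof. by rewrite /cos2 mulr0 mulr1 cos0 mulr_natl cos2pi. Qed.

Lemma sin2_01 : (sin2 0 = 0) * (sin2 1 = 0).
Proof. by rewrite /sin2 mulr0 mulr1 sin0 mulr_natl sin2pi. Qed.

Lemma integral_cos2 : I cos2 = 0.
Proof.
have dF (x : R) : is_derive x 1 ((2 * pi)^-1 \*: sin2) (cos2 x).
  have dF := is_deriveZ (2 * pi)^-1 (is_derive_sin2 x).
  by apply: is_derive_eq dF _; rewrite /GRing.scale /= mulKf.
rewrite (unit_interval_FTC continuous_cos2 dF) /=.
by rewrite !sin2_01 !scaler0 subrr.
Qed.

Lemma integral_sin2 : I sin2 = 0.
Proof.
have dF (x : R) : is_derive x 1 ((- (2 * pi)^-1) \*: cos2) (sin2 x).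
  have dF := is_deriveZ (- (2 * pi)^-1) (is_derive_cos2 x).
  by apply: is_derive_eq dF _; rewrite /GRing.scale /= mulrA mulrNN mulVf // mul1r.
by rewrite (unit_interval_FTC continuous_sin2 dF) /= !cos2_01 subrr.
Qed.

Lemma integral_cos2_sin2 : I (fun x => cos2 x * sin2 x) = 0.
Proof.
have dF (x : R) : is_derive x 1 ((2 * (2 * pi))^-1 \*: (sin2 * sin2)) (cos2 x * sin2 x).
  have dF := is_deriveZ (2 * (2 * pi))^-1 (is_deriveM (is_derive_sin2 x) (is_derive_sin2 x)).
  apply: is_derive_eq dF _; rewrite /GRing.scale /=.
  by move: (2 * pi) w_neq0 (sin2 x) (cos2 x) => w w0 s c; field.
have cf : continuous (fun x : R => cos2 x * sin2 x).
  by move=> x; apply: cvgM; [exact: continuous_cos2|exact: continuous_sin2].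
rewrite (unit_interval_FTC cf dF).
rewrite -[LHS]/((2 * (2 * pi))^-1 * (sin2 1 * sin2 1) - (2 * (2 * pi))^-1 * (sin2 0 * sin2 0)).
by rewrite !sin2_01 subrr.
Qed.

Lemma integral_cos2_sqr : I (fun x => cos2 x * cos2 x) = 2^-1.
Proof.
have dF (x : R) : is_derive x 1 (2^-1 \*: id + (2 * (2 * pi))^-1 \*: (cos2 * sin2))
    (cos2 x * cos2 x).
  have dF := is_deriveD (is_deriveZ 2^-1 (is_derive_id x 1))
    (is_deriveZ (2 * (2 * pi))^-1 (is_deriveM (is_derive_cos2 x) (is_derive_sin2 x))).
  apply: is_derive_eq dF _; rewrite /GRing.scale /=.
  have : sin2 x * sin2 x = 1 - cos2 x * cos2 x by rewrite -!expr2 [LHS]sin2cos2.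
  move: (2 * pi) w_neq0 (sin2 x) (cos2 x) => w w0 s c E.
  transitivity (2^-1 * (1 + c * c - s * s)); last by rewrite E; field.
  by field.
have cf : continuous (fun x : R => cos2 x * cos2 x).
  by move=> x; apply: cvgM; exact: continuous_cos2.
rewrite (unit_interval_FTC cf dF).
rewrite -[LHS]/(2^-1 * 1 + (2 * (2 * pi))^-1 * (cos2 1 * sin2 1) -
  (2^-1 * 0 + (2 * (2 * pi))^-1 * (cos2 0 * sin2 0))).
by rewrite !sin2_01 !mulr0 !addr0 subr0 mulr1.
Qed.

Lemma bounded_measurable_cos2 : bounded_measurable (cos2 : measurableTypeR R -> R).
Proof.
split; first by apply: continuous_measurable_fun; exact: continuous_cos2.
by exists 1 => x; exact: cos_max.
Qed.

Lemma bounded_measurable_sin2 : bounded_measurable (sin2 : measurableTypeR R -> R).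
Proof.
split; first by apply: continuous_measurable_fun; exact: continuous_sin2.
by exists 1 => x; exact: sin_max.
Qed.

Lemma bounded_measurable_coord n (p : measurableTypeR R -> R) (i : 'I_n) :
  bounded_measurable p ->
  bounded_measurable (fun t : @tupleR R n => p (tnth t i)).
Proof.
move=> [mp [M pM]]; split; last by exists M => t; exact: pM.
by apply: measurableT_comp mp _; exact: measurable_tnth.
Qed.

Lemma cube_integral_cst n (r : R) : J n (fun=> r) = r.
Proof.
rewrite Rintegral_cst; last exact: measurable_cube.
by rewrite [X in fine X]lebesgue_cube mulr1.
Qed.

Definition t0 n (t : @tupleR R n.+2) : R := tnth t ord0.
Definition t1 n (t : @tupleR R n.+2) : R := tnth t (lift ord0 ord0).

(** Two coordinates are split off in turn; the remaining ones integrate the constant 1. *)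
Lemma cube_integral_split n (p q : measurableTypeR R -> R) :
  bounded_measurable p -> bounded_measurable q ->
  J n.+2 (fun t => p (t0 t) * q (t1 t)) = I p * I q.
Proof.
move=> bp bq; have bq' := bounded_measurable_coord (ord0 : 'I_n.+1) bq.
rewrite (@cube_integral_cons R _ _ (fun s => q (tnth s ord0)) p) //.
- rewrite mulrC (@cube_integral_cons R _ _ (fun=> 1) q) //.
  + by rewrite cube_integral_cst mul1r.
  + exact: bounded_measurable_cst.
  + by move=> s x; rewrite tnth0 mul1r.
- by apply: bounded_measurableM; exact: bounded_measurable_coord.
- by move=> s x; rewrite /t0 /t1 tnth0 tnthS mulrC.
Qed.

End trigonometric_integrals.

(** * The counterexample *)

Section counterexample.
Local Open Scope classical_set_scope.
Local Open Scope ring_scope.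
Context {R : realType}.
Variables (m n : nat).
Local Notation J f := (\int[@lebesgue_tuple R n.+3]_(t in @cube R n.+3) f t).
Local Notation P := (@pencil R m.+4 n.+3).

Lemma integrand_pencil (a b c : R) (S := a ^+ 2 + b ^+ 2 + c ^+ 2) :
  integrand (P a b c) = - (a * b * c) + (S + S ^+ 2) / 100.
Proof.
have paE : pa (P a b c) = a by rewrite /pa mxE !inordK.
have pbE : pb (P a b c) = b by rewrite /pb mxE /= addr0.
have pcE : pc (P a b c) = c by rewrite /pc mxE /= inordK //= add0r.
rewrite /integrand /remainder paE pbE pcE subrr.
rewrite (_ : sqnorm 0 = 0) ?mulr0 ?addr0 // /sqnorm.
by rewrite big1 // => i _; rewrite big1 // => j _; rewrite mxE expr0n.
Qed.

(** The addition formula separates the variables in the third wave, as [cube_integral_split]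
    requires. *)
Lemma field_row (t : @tupleR R n.+3) :
  @field R m n (\row_i tnth t i) =
  P (cos2 (t0 t)) (cos2 (t1 t)) (cos2 (t0 t) * cos2 (t1 t) - sin2 (t0 t) * sin2 (t1 t)).
Proof.
rewrite /field !dot_freq !mxE /= !mulr1n !mulr0n addr0 add0r.
by rewrite [2 * pi * (_ + _)]mulrDr cosD.
Qed.

Let bc := @bounded_measurable_cos2 R.
Let bs := @bounded_measurable_sin2 R.
Let b1 := @bounded_measurable_cst R _ (measurableTypeR R) 1.

Let bounded_measurable_split (p q : measurableTypeR R -> R) :
  bounded_measurable p -> bounded_measurable q ->
  bounded_measurable (fun t : @tupleR R n.+3 => p (t0 t) * q (t1 t)).
Proof.
by move=> bp bq; apply: bounded_measurableM; exact: bounded_measurable_coord.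
Qed.

Lemma mean_field : cube_integral_mx (@field R m n) = 0.
Proof.
apply/matrixP => i j; rewrite !mxE /cube_integral.
(* The factors 1 in [A] and [B] give them the product form of [cube_integral_split]. *)
pose A (t : @tupleR R n.+3) := cos2 (t0 t) * 1.
pose B (t : @tupleR R n.+3) := 1 * cos2 (t1 t).
pose C (t : @tupleR R n.+3) := cos2 (t0 t) * cos2 (t1 t).
pose D (t : @tupleR R n.+3) := sin2 (t0 t) * sin2 (t1 t).
have bA : bounded_measurable A := bounded_measurable_split bc b1.
have bB : bounded_measurable B := bounded_measurable_split b1 bc.
have bC : bounded_measurable C := bounded_measurable_split bc bc.
have bD : bounded_measurable D := bounded_measurable_split bs bs.
have JA : J A = 0 by rewrite (cube_integral_split n.+1 bc b1) integral_cos2 mul0r.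
have JB : J B = 0 by rewrite (cube_integral_split n.+1 b1 bc) integral_cos2 mulr0.
have JC : J C = 0 by rewrite (cube_integral_split n.+1 bc bc) integral_cos2 mulr0.
have JD : J D = 0 by rewrite (cube_integral_split n.+1 bs bs) integral_sin2 mulr0.
have mcube := @measurable_cube R n.+3.
have bE : bounded_measurable (fun t => C t - D t).
  by apply: bounded_measurableD => //; exact: bounded_measurableN.
have bZ f (r : R) : bounded_measurable f -> bounded_measurable (fun t : @tupleR R n.+3 => f t * r).
  by move=> bf; apply: bounded_measurableM => //; exact: bounded_measurable_cst.
transitivity (J (fun t => A t * P 1 0 0 i j + B t * P 0 1 0 i j + (C t - D t) * P 0 0 1 i j)).
  apply: eq_Rintegral => t _; rewrite field_row pencil_lin.
  rewrite [LHS]mxE [X in X + _ = _]mxE /A /B mulr1 mul1r.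
  by congr (_ + _ + _); rewrite [LHS]mxE.
rewrite RintegralD //; [|apply: cube_integrable|apply: cube_integrable; exact: bZ]; last first.
  by apply: bounded_measurableD; exact: bZ.
rewrite RintegralD //; [|apply: cube_integrable; exact: bZ|apply: cube_integrable; exact: bZ].
have JZ f (r : R) : bounded_measurable f -> J (fun t => f t * r) = J f * r.
  by move=> bf; apply: RintegralZr => //; exact: cube_integrable.
rewrite (JZ _ _ bA) (JZ _ _ bB) (JZ _ _ bE).
rewrite RintegralB //; [|exact: cube_integrable|exact: cube_integrable].
by rewrite JA JB JC JD subrr !mul0r !addr0.
Qed.

(** The cubic term averages to 0 - (1/2)(1/2) = - 1/4. The three coordinates are cosines, so S <= 3
    and the rest is at most (3 + 9) / 100. *)
Lemma integral_field_lt0 : cube_integral (fun x => integrand (@field R m n x)) < 0.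
Proof.
have num : - 4^-1 + 12 / 100 < 0 :> R by lra.
have sum3 (x y z : R) : x <= 1 -> y <= 1 -> z <= 1 -> x + y + z <= 3 by lra.
have sum12 (x y : R) : x <= 3 -> y <= 9 -> (x + y) * 100^-1 <= 12 / 100 by lra.
pose A (t : @tupleR R n.+3) := cos2 (t0 t).
pose B (t : @tupleR R n.+3) := cos2 (t1 t).
pose C (t : @tupleR R n.+3) := A t * B t - sin2 (t0 t) * sin2 (t1 t).
pose S (t : @tupleR R n.+3) := A t * A t + B t * B t + C t * C t.
pose G t := - (A t * B t * C t) + (S t + S t * S t) * 100^-1.
have bA : bounded_measurable A by exact: bounded_measurable_coord.
have bB : bounded_measurable B by exact: bounded_measurable_coord.
have bC : bounded_measurable C.
  apply: bounded_measurableD; first exact: bounded_measurable_split bc bc.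
  by apply: bounded_measurableN; exact: bounded_measurable_split bs bs.
have bS : bounded_measurable S by do 2?apply: bounded_measurableD; exact: bounded_measurableM.
have bG : bounded_measurable G.
  apply: bounded_measurableD.
    by apply: bounded_measurableN; do 2?apply: bounded_measurableM.
  apply: bounded_measurableM; last exact: bounded_measurable_cst.
  by apply: bounded_measurableD => //; exact: bounded_measurableM.
have GE : cube_integral (fun x => integrand (@field R m n x)) = J G.
  apply: eq_Rintegral => t _.
  by rewrite field_row integrand_pencil /G /S /C -/(A t) -/(B t) !expr2.
pose cs (x : measurableTypeR R) := cos2 x * sin2 x.
pose cc (x : measurableTypeR R) := cos2 x * cos2 x.
have bcs : bounded_measurable cs by exact: bounded_measurableM.
have bcc : bounded_measurable cc by exact: bounded_measurableM.
pose H (t : @tupleR R n.+3) := cs (t0 t) * cs (t1 t) - cc (t0 t) * cc (t1 t).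
have bH : bounded_measurable H.
  apply: bounded_measurableD; first exact: bounded_measurable_split.
  by apply: bounded_measurableN; exact: bounded_measurable_split.
have GH t : G t <= H t + 12 / 100.
  have sq1 (x : R) : `|x| <= 1 -> x * x <= 1.
    by move=> x1; rewrite -expr2 -real_normK ?num_real // expr_le1.
  have A1 : A t * A t <= 1 by apply: sq1; exact: cos_max.
  have B1 : B t * B t <= 1 by apply: sq1; exact: cos_max.
  have C1 : C t * C t <= 1 by apply: sq1; rewrite /C /A /B /cos2 /sin2 -cosD; exact: cos_max.
  have S3 : S t <= 3 by exact: sum3.
  have S0 : 0 <= S t by rewrite !addr_ge0 // -expr2 sqr_ge0.
  have S9 : S t * S t <= 9.
    by rewrite (_ : 9 = 3 * 3) ?ler_pM //; ring.
  have -> : H t = - (A t * B t * C t) by rewrite /H /cs /cc /C /A /B; ring.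
  by rewrite lerD2l; exact: sum12.
have mcube := @measurable_cube R n.+3.
have JH : J H = - 4^-1.
  rewrite RintegralB //; [|apply: cube_integrable; exact: bounded_measurable_split
    |apply: cube_integrable; exact: bounded_measurable_split].
  rewrite (cube_integral_split n.+1 bcs bcs) (cube_integral_split n.+1 bcc bcc).
  by rewrite integral_cos2_sin2 integral_cos2_sqr; field.
rewrite GE; apply: (@le_lt_trans _ _ (J (fun t => H t + 12 / 100))).
  apply: le_Rintegral => //; first exact: cube_integrable.
  apply: cube_integrable; apply: bounded_measurableD => //.
  exact: bounded_measurable_cst.
rewrite RintegralD //; [|exact: cube_integrable
  |by apply: cube_integrable; exact: bounded_measurable_cst].
by rewrite cube_integral_cst JH.
Qed.

Lemma integrand_not_S_quasiconvex : ~ S_quasiconvex (@integrand R m n).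
Proof.
move=> /(_ (@field R m n) (@field_smooth R m n) (@field_periodic R m n)
  (@field_Div R m n)); apply/negP; rewrite -ltNge mean_field.
(* The mean of the field lies in the pencil, where the integrand is explicit and takes the value
   0. *)
have -> : (0 : 'M[R]_(m.+4, n.+3)) = P 0 0 0 by rewrite pencil_lin !scale0r !addr0.
rewrite integrand_pencil (_ : - _ + _ = 0); first exact: integral_field_lt0.
by ring.
Qed.

End counterexample.

Theorem theorem1p2 (R : realType) (m n : nat)
    (n_ge3 : (3 <= n)%N) (m_gtn : (n + 1 <= m)%N) :
  exists F : 'M[R]_(m, n) -> R,
    rank_convex (n - 1) F /\ ~ S_quasiconvex F.
Proof.
(* With [n.+3] columns and [m.+4] rows, the size condition computes to [n <= m]. *)
case: n n_ge3 m_gtn => [|[|[|n]]] // _; case: m => [|[|[|[|m]]]] //; rewrite addn1 // => nm.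
exists (@integrand R m n); rewrite subn1; split.
  exact: integrand_rank_convex.
exact: integrand_not_S_quasiconvex.
Qed.
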